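(* Let $\mu$ be a candidate probability measure on $\mathbb R$, let $(X_t)_{t\ge1}$ be a stationary ergodic real-valued sequence with empirical measures $\hat\mu_n=\frac1n\sum_{t=1}^n\delta_{X_t}$, and let $T_n:=\sqrt n\,W_1(\hat\mu_n,\mu)$. Let $\alpha\in(0,1)$ and let $q_{1-\alpha}$ be the $(1-\alpha)$-quantile of the null limiting random variable $\mathbb G=\int_{\mathbb R}|G(t)|\,dt$ described in the context (a fixed finite number not depending on $n$). Suppose that (under the alternative $H_A$) $\hat\mu_n\to\nu$ weakly almost surely, where $\nu$ is a probability measure on $\mathbb R$ with $W_1(\nu,\mu)>0$. Then the test that rejects whenever $T_n>q_{1-\alpha}$ is consistent: $$\mathbb P_{H_A}(T_n>q_{1-\alpha})\to 1\qquad(n\to\infty).$$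
   Context: $W_1$ is the 1-Wasserstein distance; on $\mathbb R$ it equals $W_1(\nu_1,\nu_2)=\int_{\mathbb R}|F_{\nu_1}(t)-F_{\nu_2}(t)|\,dt\in[0,\infty]$, where $F_\nu$ is the distribution function of $\nu$. $\delta_x$ is the Dirac measure at $x$. The test concerns $H_0:\hat\mu_n\to\mu$ versus $H_A:\hat\mu_n\to\nu\ne\mu$; $\mathbb P_{H_A}$ is probability under $H_A$. The $(1-\alpha)$-quantile of a real random variable $Z$ is $\inf\{x\in\mathbb R:\mathbb P(Z\le x)\ge 1-\alpha\}$. $G$ is a centered Gaussian random element of $L^1(\mathbb R)$ (so $\mathbb G<\infty$ almost surely), namely the limit process under $H_0$: for a stationary reference sequence $(X^0_k)_{k\in\mathbb Z}$ with marginal law $\mu$ and distribution function $F$, and all bounded measurable $f,g:\mathbb R\to\mathbb R$, $$\operatorname{Cov}\Bigl(\int f(t)G(t)\,dt,\int g(t)G(t)\,dt\Bigr)=\sum_{k\in\mathbb Z}\mathbb E\Bigl(\iint f(t)g(s)\bigl(\mathbf 1\{X^0_0\le t\}-F(t)\bigr)\bigl(\mathbf 1\{X^0_k\le s\}-F(s)\bigr)\,dt\,ds\Bigr).$$ *)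

(* Defs.v *)
From HB Require Import structures.
From mathcomp Require Import all_boot all_order all_algebra.
From mathcomp Require Import all_classical all_reals all_analysis.
Import Order.TTheory GRing.Theory Num.Theory.
Import numFieldNormedType.Exports.
Set Implicit Arguments.
Unset Strict Implicit.
Unset Printing Implicit Defensive.
Local Open Scope classical_set_scope.
Local Open Scope ring_scope.

(* The 1-Wasserstein distance on the line, as the infimal transport cost over
   all couplings; its value may be +oo. *)
Definition couplings (R : realType) (m1 m2 : set R -> \bar R) :
    set (probability (measurableTypeR R * measurableTypeR R)%type R) :=
  [set pi | forall A : set (measurableTypeR R), measurable A ->
     pi (A `*` setT) = m1 A /\ pi (setT `*` A) = m2 A].

Definition W1 (R : realType) (m1 m2 : set R -> \bar R) : \bar R :=
  ereal_inf [set (\int[pi]_z (`|z.1 - z.2|%:E))%E | pi in couplings m1 m2].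

Definition weakly_cvg (R : realType)
    (m : nat -> {measure set (measurableTypeR R) -> \bar R})
    (nu : {measure set (measurableTypeR R) -> \bar R}) :=
  forall f : R -> R, continuous f -> (exists M, forall x, `|f x| <= M) ->
    (\int[m n]_x (f x)%:E)%E @[n --> \oo] --> (\int[nu]_x (f x)%:E)%E.

(* The product sigma-algebra on the path space [I -> R], generated by the
   coordinate maps. *)
Definition path_measurable (R : realType) (I : Type) : set (set (I -> R)) :=
  <<s [set A | exists (i : I) (B : set (measurableTypeR R)),
         measurable B /\ A = [set x | B (x i)]] >>.

(* [sh] is the index shift: [succn] for one-sided sequences, [+ 1] on [int]
   for two-sided ones. *)
Definition stationary (R : realType) (d : measure_display)
    (T : measurableType d) (P : probability T R) (I : Type) (sh : I -> I)
    (X : I -> T -> R) :=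
  forall A : set (I -> R), path_measurable A ->
    P [set w | A (fun i => X (sh i) w)] = P [set w | A (fun i => X i w)].

Definition ergodic (R : realType) (d : measure_display)
    (T : measurableType d) (P : probability T R) (I : Type) (sh : I -> I)
    (X : I -> T -> R) :=
  forall A : set (I -> R), path_measurable A ->
    (forall x, A (x \o sh) <-> A x) ->
    P [set w | A (fun i => X i w)] = 0%E \/ P [set w | A (fun i => X i w)] = 1%E.

(* Sequences are indexed from 0, so the first n terms are X 0, ..., X n.-1.
   For n = 0 this is the zero measure. *)
Definition empirical (R : realType) (T : Type) (X : nat -> T -> R) (n : nat)
    (w : T) : {measure set (measurableTypeR R) -> \bar R} :=
  mscale (n%:R^-1)%:nng
    (msum (fun i => \d_(X i w : measurableTypeR R)) n).

Definition test_stat (R : realType) (T : Type) (X : nat -> T -> R)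
    (mu : set R -> \bar R) (n : nat) (w : T) : \bar R :=
  ((Num.sqrt n%:R)%:E * W1 (empirical X n w) mu)%E.

Definition quantile (R : realType) (d : measure_display)
    (T : measurableType d) (P : probability T R) (Z : T -> R) (p : R) : R :=
  inf [set x : R | (p%:E <= P [set w | (Z w <= x)%R])%E].

(* L^1(R) for Lebesgue measure, as the library's quotient by a.e. equality;
   elements coerce to a representative. *)
Definition L1 (R : realType) := LspaceType1 (@lebesgue_measure R).

Definition L1_fun (R : realType) (f : L1 R) : R -> R := f.

Definition L1_norm (R : realType) (f : L1 R) : R :=
  \int[@lebesgue_measure R]_t `|L1_fun f t|.

Definition L1_dist (R : realType) (f g : L1 R) : \bar R :=
  (\int[@lebesgue_measure R]_t `|L1_fun f t - L1_fun g t|%:E)%E.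

Definition L1_open (R : realType) (U : set (L1 R)) :=
  forall f, U f -> exists2 e : R, 0 < e &
    forall g, (L1_dist f g < e%:E)%E -> U g.

Definition L1_random_element (R : realType) (d : measure_display)
    (T : measurableType d) (G : T -> L1 R) :=
  forall U : set (L1 R), L1_open U -> measurable (G @^-1` U).

(* The continuous linear functionals on L^1(R); linearity is phrased through
   a.e. equality because the quotient carries no module structure. *)
Definition L1_dual (R : realType) (phi : L1 R -> R) :=
  (forall (a : R) (f g h : L1 R),
     {ae @lebesgue_measure R, forall t,
        L1_fun h t = a * L1_fun f t + L1_fun g t} ->
     phi h = a * phi f + phi g) /\
  exists C : R, forall f : L1 R, `|phi f| <= C * L1_norm f.

(* The law N(0, s^2). The degenerate case is separate because [normal_prob m 0]
   is the uniform law on [0, 1], not a Dirac mass. *)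
Definition centered_normal (R : realType) (s : R)
    (A : set (measurableTypeR R)) : \bar R :=
  if s == 0 then \d_(0 : measurableTypeR R) A else normal_prob 0 s A.

Definition L1_centered_gaussian (R : realType) (d : measure_display)
    (T : measurableType d) (P : probability T R) (G : T -> L1 R) :=
  L1_random_element G /\
  forall phi : L1 R -> R, L1_dual phi ->
    exists s : R, forall A : set (measurableTypeR R), measurable A ->
      P [set w | A (phi (G w))] = centered_normal s A.

Definition df (R : realType) (mu : probability (measurableTypeR R) R) (t : R) : R :=
  fine (mu [set x : R | x <= t]).

Definition null_integrand (R : realType)
    (mu : probability (measurableTypeR R) R) (f g : R -> R) (x y : R)
    (z : measurableTypeR R * measurableTypeR R) : R :=
  f z.1 * g z.2 * ((x <= z.1)%R%:R - df mu z.1) * ((y <= z.2)%R%:R - df mu z.2).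

Definition null_double_int (R : realType)
    (mu : probability (measurableTypeR R) R) (f g : R -> R) (x y : R) : R :=
  \int[(@lebesgue_measure R \x @lebesgue_measure R)%E]_z
    null_integrand mu f g x y z.

Definition bounded_measurable (R : realType) (f : R -> R) :=
  measurable_fun setT (f : measurableTypeR R -> measurableTypeR R) /\
  exists M, forall t, `|f t| <= M.

Definition null_cov_term (R : realType)
    (mu : probability (measurableTypeR R) R)
    (d0 : measure_display) (T0 : measurableType d0) (P0 : probability T0 R)
    (X0 : int -> T0 -> R) (f g : R -> R) (k : int) : \bar R :=
  expectation P0 (fun w => null_double_int mu f g (X0 0 w) (X0 k w)).

(* Covariance structure of the null limit built on the two-sided sequence X0.
   The first two clauses say that the double integrals and the expectations are
   genuine (absolutely convergent); integrals and expectations are otherwise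
   total functions with arbitrary values.  The series over int is the
   limit of its symmetric partial sums over |k| <= n. *)
Definition null_covariance (R : realType)
    (mu : probability (measurableTypeR R) R)
    (d0 : measure_display) (T0 : measurableType d0) (P0 : probability T0 R)
    (X0 : int -> T0 -> R)
    (d : measure_display) (T : measurableType d) (P : probability T R)
    (G : T -> L1 R) :=
  forall f g : R -> R, bounded_measurable f -> bounded_measurable g ->
  [/\ forall (k : int) (w : T0),
        (@lebesgue_measure R \x @lebesgue_measure R)%E.-integrable setT
          (EFin \o null_integrand mu f g (X0 0 w) (X0 k w)),
      forall k : int, P0.-integrable setT
        (fun w => (null_double_int mu f g (X0 0 w) (X0 k w))%:E)
    & (\sum_(0 <= i < n.*2.+1) null_cov_term mu P0 X0 f g (i%:Z - n%:Z)%R)%E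
        @[n --> \oo] -->
      covariance P
        (fun w => \int[@lebesgue_measure R]_t (f t * L1_fun (G w) t))
        (fun w => \int[@lebesgue_measure R]_t (g t * L1_fun (G w) t))].

(* Main.v *)
Require Import Defs.
From HB Require Import structures.
From mathcomp Require Import all_boot all_order all_algebra.
From mathcomp Require Import all_classical all_reals all_analysis.
From mathcomp Require Import measurable_realfun lra.
Import Order.TTheory GRing.Theory Num.Theory.
Import numFieldNormedType.Exports.
Set Implicit Arguments.
Unset Strict Implicit.
Unset Printing Implicit Defensive.
Local Open Scope classical_set_scope.
Local Open Scope ring_scope.

(** If [nu] differs from [mu], some ramp [t |-> max 0 (min e (t - a))] has
    different integrals against the two laws.  Ramps are bounded and
    1-Lipschitz, so any coupling costs at least the difference of the ramp
    integrals of its marginals; weak convergence therefore keeps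
    [W1 (empirical X n w) mu] above a positive constant for large n, and the
    factor [sqrt n] takes the statistic past any fixed threshold, almost surely.

    Passing to probabilities needs the rejection events to be measurable.  If
    [h] moves points by at most [e], pushing couplings along [h] shows that the
    distance to [mu] grows by at most [e].  A sample can thus be replaced by a
    nearby rational one with the same coincidences between its entries, and back,
    which writes [{W1 < c}] as a countable union of measurable sets. *)

(** Couplings are bundled probabilities, so a transported coupling must be one too; it is the law of
    [f] seen as a random variable. *)
Lemma pushforward_probability (R : realType) (d d' : measure_display)
    (T : measurableType d) (T' : measurableType d') (P : probability T R)
    (f : T -> T') : measurable_fun setT f ->
  exists Q : probability T' R, (Q : set T' -> \bar R) = pushforward P f.
Proof.
move=> mf.
pose F : {mfun T >-> T'} := HB.pack f (isMeasurableFun.Build _ _ _ _ f mf).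
by exists (distribution P F).
Qed.

(** * Transport of empirical measures and measurability of the distance *)

Section transport.
Context {R : realType}.
Implicit Types (x y : nat -> R) (mu : set R -> \bar R).

Local Notation emp x n := (empirical (fun i (z : nat -> R) => z i) n x).

Lemma empiricalE x n (A : set R) :
  emp x n A = (n%:R^-1%:E * \sum_(k < n) (\1_A (x k))%:E)%E.
Proof. by []. Qed.

Lemma eq_empirical x y n : (forall i, (i < n)%N -> x i = y i) ->
  (emp x n : set _ -> \bar R) = emp y n.
Proof.
move=> xy; apply/funext => A; rewrite !empiricalE; congr (_ * _)%E.
by apply: eq_bigr => k _; rewrite xy.
Qed.

Lemma measurable_dist (d : measure_display) (T : measurableType d)
   (f g : T -> measurableTypeR R) :
  measurable_fun setT f -> measurable_fun setT g ->
  measurable_fun setT (fun z => `|f z - g z|%:E).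
Proof.
move=> mf mg; apply/measurable_EFinP; apply: measurableT_comp => //.
exact: measurable_funB.
Qed.

(* The interpolant is the identity away from the nodes, which keeps it uniformly
   close to the identity. *)
Lemma measurable_interpolation (e : R) (x y : nat -> R) n : 0 <= e ->
  (forall i, (i < n)%N -> `|y i - x i| <= e) ->
  (forall i j, (i < n)%N -> (j < n)%N -> x i = x j -> y i = y j) ->
  exists h : measurableTypeR R -> measurableTypeR R, [/\ measurable_fun setT h,
    forall t, `|h t - t| <= e & forall i, (i < n)%N -> h (x i) = y i].
Proof.
move=> e0; elim: n => [|n IHn] yxe xy.
  by exists id; split => // t; rewrite subrr normr0.
have [||h [mh he hx]] := IHn.
- by move=> i ni; apply: yxe; rewrite ltnS ltnW.
- by move=> i j ni nj; apply: xy; rewrite ltnS ltnW.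
(* The map changes at the new node only; if [x n] repeats an earlier node, the coincidence
   hypothesis makes the prescribed values agree. *)
exists (fun t => if t == x n then y n else h t); split.
- apply: measurable_fun_ifT => //.
  by apply: measurable_fun_eqr.
- by move=> t; case: eqP => [->|_] //; exact: yxe.
- move=> i; rewrite ltnS leq_eqVlt => /predU1P[->|ni]; first by rewrite eqxx.
  case: eqP => [xin|_]; last exact: hx.
  by apply: xy => //; rewrite ltnS ltnW.
Qed.

(** Each coupling is pushed along [(h, id)]: this replaces the first marginal by its image and, by
    the triangle inequality and total mass one, raises the cost by at most [e]. *)
Lemma W1_pushforward (e : R) (h : measurableTypeR R -> measurableTypeR R)
    (m1 m2 : set R -> \bar R) :
  measurable_fun setT h -> (forall t, `|h t - t| <= e) ->
  (W1 (fun A => m1 (h @^-1` A)) m2 <= W1 m1 m2 + e%:E)%E.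
Proof.
move=> mh he; have e0 : 0 <= e by apply: le_trans (he 0).
rewrite -leeBlDr//; apply: le_ereal_inf_tmp => _ [pi cpi <-].
rewrite leeBlDr//.
pose hh (z : measurableTypeR R * measurableTypeR R) := (h z.1, z.2).
have mhh : measurable_fun setT hh.
  by apply: measurable_fun_pair => //; exact: measurableT_comp mh _.
have [Q QE] := pushforward_probability pi mhh.
apply: (@le_trans _ _ (\int[Q]_z `|z.1 - z.2|%:E)%E).
  apply: ereal_inf_lbound; exists Q => // A mA; rewrite QE /pushforward; split.
    rewrite (_ : _ @^-1` _ = (h @^-1` A) `*` setT)//.
    by rewrite (cpi _ _).1// -(setTI (h @^-1` A)); exact: mh.
  by rewrite (_ : _ @^-1` _ = setT `*` A)// (cpi _ _).2.
have md : @measurable_fun _ _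
    (measurableTypeR R * measurableTypeR R)%type (\bar R) setT
    (fun z => `|z.1 - z.2|%:E).
  by apply: measurable_dist; [exact: measurable_fst|exact: measurable_snd].
rewrite QE ge0_integral_pushforward// preimage_setT.
have -> : (e%:E = \int[pi]_z cst e%:E z)%E.
  by rewrite integral_cst//= probability_setT mule1.
rewrite -ge0_integralD//; apply: ge0_le_integral => //.
- by move=> z _ /=; rewrite lee_fin.
- exact: measurableT_comp md mhh.
- exact: emeasurable_funD.
- move=> [s t] _ /=; rewrite -EFinD lee_fin.
  by rewrite (le_trans (ler_distD s _ _))// addrC lerD2l.
Qed.

(** The interpolant sends the sample [x] to [y], so the empirical measure of [y] is the image of
    that of [x]. *)
Lemma W1_empirical_le (e : R) x y n mu : 0 <= e ->
  (forall i, (i < n)%N -> `|y i - x i| <= e) ->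
  (forall i j, (i < n)%N -> (j < n)%N -> x i = x j -> y i = y j) ->
  (W1 (emp y n) mu <= W1 (emp x n) mu + e%:E)%E.
Proof.
move=> e0 yx xy; have [h [mh he hx]] := measurable_interpolation e0 yx xy.
rewrite (@eq_empirical y (h \o x)); last by move=> i /hx /esym.
exact: W1_pushforward mh he.
Qed.

Lemma measurable_same_pattern (d : measure_display) (T : measurableType d)
    (X : nat -> T -> measurableTypeR R) (r : nat -> R) (e : R) n :
  (forall i, measurable_fun setT (X i)) ->
  measurable [set w | forall i j : 'I_n,
    `|X i w - r i| < e /\ (X i w = X j w <-> r i = r j)].
Proof.
move=> mX; rewrite (_ : mkset _ = \bigcap_(i in [set: 'I_n])
    \bigcap_(j in [set: 'I_n])
    ((fun w => `|X i w - r i| < e) @^-1` [set true] `&`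
     (fun w => (X i w == X j w) == (r i == r j)) @^-1` [set true])); last first.
  apply/seteqP; split => w /= H i.
    move=> _ j _; have [? [H1 H2]] := H i j; split => //=.
    by apply/eqP; apply/idP/idP => /eqP ?; apply/eqP; [exact: H1|exact: H2].
  move=> j; have [/= ? /eqP H1] := H i I j I; split => //.
  by split => /eqP; [rewrite H1|rewrite -H1] => /eqP.
apply: fin_bigcap_measurable => // i _; apply: fin_bigcap_measurable => // j _.
apply: measurableI; rewrite -[X in measurable X]setTI.
  have mB := measurable_funB (mX i) (measurable_cst (r i)).
  have mf := measurable_fun_ltr
    (measurableT_comp (@normr_measurable R setT) mB) (measurable_cst e).
  exact: mf.
have mf := measurable_fun_eqr (mX i) (mX j).
exact: (mf measurableT [set b | (b == (r i == r j)) = true]).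
Qed.

Lemma exists_rat_same_pattern x n (e : R) : 0 < e -> exists r : nat -> rat,
  forall i j : 'I_n,
    `|x i - ratr (r i)| < e /\ (x i = x j <-> ratr (r i) = ratr (r j) :> R).
Proof.
move=> e0.
(* [d] is at most half of every nonzero gap, so approximations closer than [d] cannot merge distinct
   entries. *)
have [d /= [d0 de dx]] : exists d : R, [/\ 0 < d, d <= e &
    forall i j : 'I_n, x i != x j -> 2 * d <= `|x i - x j|].
  near (0 : R)^'+ => d; exists d; split => //; near: d.
    exact: nbhs_right_le.
  apply: filter_forall => i; apply: filter_forall => j.
  have [_|xij] := eqVneq (x i) (x j); first exact: nearW.
  near=> d => _; rewrite mulrC -ler_pdivlMr//; near: d.
  by apply: nbhs_right_le; rewrite divr_gt0// normr_gt0 subr_eq0.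
have h (t : R) : exists q : rat, `|t - ratr q| < d.
  have [q] := @rat_in_itvoo R (t - d) (t + d) ltac:(lra).
  by rewrite in_itv /= => q_; exists q; rewrite ltr_distlC.
(* The rational depends on the value and not on the index, so equal entries receive equal
   approximations. *)
have [f hf] := choice h.
exists (f \o x) => i j /=; split; first exact: lt_le_trans (hf _) de.
split => [->//|fij]; apply/eqP/negPn/negP => /dx; apply/negP; rewrite -ltNge.
rewrite (le_lt_trans (ler_distD (ratr (f (x i))) _ _))//.
rewrite {2}fij [in ltLHS](distrC _ (x j)).
by have := hf (x i); have := hf (x j); lra.
Unshelve. all: by end_near. Qed.

Lemma measurable_W1_empirical (d : measure_display) (T : measurableType d)
    (X : nat -> T -> measurableTypeR R) mu n :
  (forall i, measurable_fun setT (X i)) ->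
  measurable_fun setT (fun w => W1 (empirical X n w) mu).
Proof.
move=> mX; apply: (measurability _ (ErealGenCInfty.measurableE R)).
move=> _ [_ [c ->] <-]; rewrite setTI -[X in measurable X]setCK.
apply: measurableC.
pose V (x : nat -> R) := W1 (emp x n) mu.
(* Finite tuples keep the union countable; the padding value 0 is never read, since only the first
   [n] entries enter. *)
pose ext (r : {ffun 'I_n -> rat}) (i : nat) : R :=
  if insub i is Some i' then ratr (r i') else 0.
rewrite (_ : ~` _ = \bigcup_(re : {ffun 'I_n -> rat} * rat)
   ([set w | forall i j : 'I_n, `|X i w - ext re.1 i| < ratr re.2 /\
         (X i w = X j w <-> ext re.1 i = ext re.1 j)] `&`
    [set w | 0 < re.2 /\ (V (ext re.1) + (ratr re.2)%:E < c%:E)%E])); last first.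
  apply/seteqP; split => w /=; rewrite in_itv/= andbT.
    move=> /negP; rewrite -ltNge => Wc.
    (* The slack is twice [e]: one [e] pays for moving to the rational sample, the other is the
       margin demanded by the event. *)
    have [e e0 We] : exists2 e : rat, 0 < e &
        (W1 (empirical X n w) mu + (ratr e)%:E + (ratr e)%:E < c%:E)%E.
      case: (W1 _ _) Wc => [v|//|_]; last by exists 1 => //; exact: ltNyr.
      rewrite lte_fin => vc.
      have [q] := @rat_in_itvoo R 0 ((c - v) / 2) ltac:(lra).
      rewrite in_itv/= => /andP[q0 qc]; exists q; first by rewrite -(ltr0q R).
      by rewrite -!EFinD lte_fin; lra.
    have [r xr] := @exists_rat_same_pattern (fun i => X i w) n (ratr e)
      ltac:(by rewrite ltr0q).
    have extE (i : 'I_n) : ext [ffun i : 'I_n => r i] i = ratr (r i).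
      by rewrite /ext valK ffunE.
    exists ([ffun i : 'I_n => r i], e) => //=; split.
      by move=> i j; rewrite !extE.
    split => //; apply: le_lt_trans We; rewrite leeD2r//.
    apply: (@W1_empirical_le _ (fun i => X i w)) => [|i ni|i j ni nj /=].
    - by rewrite ler0q ltW.
    - have := xr (Ordinal ni) (Ordinal ni).
      by rewrite (extE (Ordinal ni)) distrC => -[/ltW].
    - rewrite (extE (Ordinal ni)) (extE (Ordinal nj)).
      by have [_ [+ _]] := xr (Ordinal ni) (Ordinal nj).
  (* Conversely, the margin pays for moving back from the rational sample to the observed one. *)
  move=> [[r e] _ /= [xr [e0 Ve]]]; apply/negP; rewrite -ltNge.
  apply: le_lt_trans Ve; apply: W1_empirical_le => [|i ni|i j ni nj].
  - by rewrite ler0q ltW.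
  - by have [/ltW] := xr (Ordinal ni) (Ordinal ni).
  - by have [_ [_ +]] := xr (Ordinal ni) (Ordinal nj).
apply: countable_bigcupT_measurable => // re.
apply: measurableI; first exact: measurable_same_pattern.
(* The remaining condition does not involve [w], so its set is everything or empty. *)
by have [h|h] := pselect (0 < re.2 /\ (V (ext re.1) + (ratr re.2)%:E < c%:E)%E);
  [rewrite (_ : mkset _ = setT)|rewrite (_ : mkset _ = set0)] => //;
  apply/seteqP; split.
Qed.

End transport.

(** * Ramps, and laws determined by their ramp integrals *)

Section ramp.
Context {R : realType}.
Implicit Types (a e t : R).

Definition ramp a e t : R := Num.max 0 (Num.min e (t - a)).

Lemma ramp_ge0 a e t : 0 <= ramp a e t.
Proof. by rewrite /ramp le_max lexx. Qed.

Lemma ramp_le a e t : 0 <= e -> ramp a e t <= e.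
Proof. by move=> e0; rewrite /ramp ge_max e0 ge_min lexx. Qed.

Lemma ramp_lipschitz a e s t : `|ramp a e s - ramp a e t| <= `|s - t|.
Proof.
have aux (u v : R) : ramp a e u - ramp a e v <= `|u - v|.
  rewrite lerBlDr /ramp ge_max addr_ge0 ?le_max ?lexx//=.
  have uv := ler_norm (u - v).
  have [ev|ve] := leP e (v - a).
    rewrite ge_min (le_trans (_ : e <= `|u - v| + e))// ?lerDr//.
    by rewrite lerD2l le_max lexx orbT.
  rewrite ge_min; apply/orP; right.
  rewrite (le_trans (_ : _ <= `|u - v| + (v - a)))//; first by lra.
  by rewrite lerD2l le_max lexx orbT.
by rewrite ler_norml aux lerNl opprB distrC aux.
Qed.

Lemma continuous_ramp a e : continuous (ramp a e).
Proof.
move=> t; apply/cvgrPdist_lt => d d0; near=> s.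
apply: le_lt_trans (ramp_lipschitz _ _ _ _) _; near: s.
exact: (@cvgr_dist_lt _ _ _ (nbhs t) _ id t cvg_id _ d0).
Unshelve. all: by end_near. Qed.

Lemma measurable_ramp a e :
  measurable_fun setT (ramp a e : measurableTypeR R -> measurableTypeR R).
Proof. exact: continuous_measurable_fun (@continuous_ramp a e). Qed.

Implicit Type m : {measure set (measurableTypeR R) -> \bar R}.

Lemma integral_cst_indic m (A : set (measurableTypeR R)) e : 0 <= e ->
  measurable A -> (\int[m]_t (e * \1_A t)%:E = e%:E * m A)%E.
Proof.
move=> e0 mA; under eq_integral do rewrite EFinM.
rewrite ge0_integralZl_EFin//; first by rewrite integral_indic// setIT.
exact/measurable_EFinP/measurable_indic.
Qed.

(** Beyond [a + e] the ramp has reached its height [e]; with the matching upper bound, this squeezes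
    its integral between multiples of tail masses. *)
Lemma le_integral_ramp m a e : 0 <= e ->
  (e%:E * m `](a + e)%R, +oo[%classic <= \int[m]_t (ramp a e t)%:E)%E.
Proof.
move=> e0; rewrite -[leLHS](_ :
  \int[m]_t (e * \1_(`](a + e)%R, +oo[%classic) t)%:E = _)%E;
  last exact: integral_cst_indic.
apply: ge0_le_integral => //.
- by move=> t _; rewrite lee_fin mulr_ge0.
- by apply/measurable_EFinP/measurable_funM => //; exact: measurable_indic.
- by apply/measurable_EFinP; exact: measurable_ramp.
- move=> t _; rewrite lee_fin indicE; case: (boolP (t \in _)) => ta; last first.
    by rewrite mulr0 ramp_ge0.
  move: ta; rewrite inE /= in_itv/= andbT mulr1 => ta.
  by rewrite /ramp le_max le_min lexx/=; apply/orP; right; lra.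
Qed.

Lemma integral_ramp_le m a e : 0 <= e ->
  (\int[m]_t (ramp a e t)%:E <= e%:E * m `]a, +oo[%classic)%E.
Proof.
move=> e0; rewrite -[leRHS](_ :
  \int[m]_t (e * \1_(`]a, +oo[%classic) t)%:E = _)%E;
  last exact: integral_cst_indic.
apply: ge0_le_integral => //.
- by move=> t _; rewrite lee_fin ramp_ge0.
- by apply/measurable_EFinP; exact: measurable_ramp.
- by apply/measurable_EFinP/measurable_funM => //; exact: measurable_indic.
- move=> t _; rewrite lee_fin indicE; case: (boolP (t \in _)) => ta.
    by rewrite mulr1 ramp_le.
  move: ta; rewrite notin_setE /= in_itv/= andbT => /negP; rewrite -leNgt => ta.
  by rewrite mulr0 /ramp ge_max lexx ge_min subr_le0 ta orbT.
Qed.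

(** Using the lower ramp bound for one law and the upper bound for the other, then dividing by [e]
    and letting it tend to 0, compares the masses of open upper rays, a pi-system generating the
    Borel sets. *)
Lemma integral_ramp_eq (m1 m2 : probability (measurableTypeR R) R) :
  (forall a e, 0 < e ->
    (\int[m1]_t (ramp a e t)%:E = \int[m2]_t (ramp a e t)%:E)%E) ->
  forall A, measurable A -> m1 A = m2 A.
Proof.
move=> eq12.
have le12 (p q : probability (measurableTypeR R) R) a :
    (forall a e, 0 < e ->
    (\int[p]_t (ramp a e t)%:E = \int[q]_t (ramp a e t)%:E)%E) ->
    (p `]a, +oo[%classic <= q `]a, +oo[%classic)%E.
  (* [F n] increases to the open ray, so continuity from below recovers its mass. *)
  move=> pq; pose F n := `]a + n.+1%:R^-1, +oo[%classic : set (measurableTypeR R).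
  have aF : `]a, +oo[%classic = \bigcup_n F n.
    apply/seteqP; split => t /=.
      rewrite in_itv/= andbT => at_; have := ltr_add_invr at_ => -[k tk].
      by exists k => //; rewrite /F/= in_itv/= andbT.
    move=> [k _]; rewrite /F/= !in_itv/= !andbT; apply: le_lt_trans.
    by rewrite lerDl.
  have cF : p (F n) @[n --> \oo] --> p (\bigcup_n F n).
    apply: nondecreasing_cvg_mu => [n||].
    - exact: measurable_itv.
    - by rewrite -aF.
    - move=> i j ij; apply/subsetPset => t; rewrite /F/= !in_itv/= !andbT.
      by apply: le_lt_trans; rewrite lerD2l lef_pV2 ?posrE// ler_nat.
  rewrite [leLHS](_ : _ = lim (p (F n) @[n --> \oo])); last first.
    by rewrite (cvg_lim _ cF)// aF.
  apply: lime_le; first by apply/cvg_ex; eexists; exact: cF.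
  near=> n; have n0 : 0 < n.+1%:R^-1 :> R by rewrite invr_gt0.
  (* Scaling by the height of the ramp lets both tail masses be compared with one ramp integral. *)
  rewrite -(@lee_pmul2l _ n.+1%:R^-1%:E)//.
  apply: le_trans (le_integral_ramp _ _ (ltW n0)) _.
  rewrite pq//.
  exact: integral_ramp_le _ _ (ltW n0).
have eqG a : m1 `]a, +oo[%classic = m2 `]a, +oo[%classic.
  by apply/eqP; rewrite eq_le !le12// => b e e0; rewrite eq12.
apply: (@measure_unique _ R (measurableTypeR R) (@RGenOInfty.G R)
  (fun n => `](- n%:R), +oo[%classic) _ _ _ _ m1 m2).
- exact: RGenOInfty.measurableE.
- move=> _ _ [a ->] [b ->]; exists (Num.max a b).
  by apply/seteqP; split => t /=; rewrite !in_itv/= !andbT gt_max => /andP.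
- by move=> i; eexists.
- rewrite -subTset => t _ /=; exists (Num.truncn (- t)).+1 => //=.
  by rewrite in_itv/= andbT ltrNl truncnS_gt.
- by move=> _ [a ->]; exact: eqG.
- by move=> k; apply: (le_lt_trans (probability_le1 _ _)) (ltry _).
Unshelve. all: by end_near. Qed.

End ramp.

(** * Ramp integrals as lower bounds for the Wasserstein distance *)

Section W1_lower_bound.
Context {R : realType}.
Implicit Types (m : {measure set (measurableTypeR R) -> \bar R}).

Lemma integral_couplings m1 m2 pi (f : measurableTypeR R -> R) :
  couplings m1 m2 pi -> measurable_fun setT f -> (forall t, 0 <= f t) ->
  (\int[m1]_t (f t)%:E = \int[pi]_z (f z.1)%:E)%E /\
  (\int[m2]_t (f t)%:E = \int[pi]_z (f z.2)%:E)%E.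
Proof.
move=> cpi mf f0; have mEf : measurable_fun setT (EFin \o f).
  exact/measurable_EFinP.
split.
  rewrite (@eq_measure_integral _ _ _ _ (pushforward pi fst)) => [|A mA _].
    by rewrite ge0_integral_pushforward// => t _ /=; rewrite lee_fin.
  rewrite /pushforward -(cpi A mA).1; congr (pi _).
  by apply/seteqP; split => z //= [].
rewrite (@eq_measure_integral _ _ _ _ (pushforward pi snd)) => [|A mA _].
  by rewrite ge0_integral_pushforward// => t _ /=; rewrite lee_fin.
rewrite /pushforward -(cpi A mA).2; congr (pi _).
by apply/seteqP; split => z //= [].
Qed.

(** The easy half of Kantorovich-Rubinstein duality: under any coupling, [f z.1] and [f z.2] differ
    by at most the cost. *)
Lemma lipschitz_integral_W1 m1 m2 (f : measurableTypeR R -> R) :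
  measurable_fun setT f -> (forall t, 0 <= f t) ->
  (forall s t, `|f s - f t| <= `|s - t|) ->
  (\int[m1]_t (f t)%:E)%E \is a fin_num ->
  (\int[m2]_t (f t)%:E)%E \is a fin_num ->
  (`|\int[m1]_t (f t)%:E - \int[m2]_t (f t)%:E| <= W1 m1 m2)%E.
Proof.
move=> mf f0 fL fin1 fin2; apply: le_ereal_inf_tmp => _ [pi cpi <-].
have [E1 E2] := integral_couplings cpi mf f0.
have m_1 : measurable_fun setT
    (fun z : measurableTypeR R * measurableTypeR R => (f z.1)%:E).
  by apply/measurable_EFinP; exact: measurableT_comp mf _.
have m_2 : measurable_fun setT
    (fun z : measurableTypeR R * measurableTypeR R => (f z.2)%:E).
  by apply/measurable_EFinP; exact: measurableT_comp mf _.
have md : measurable_fun setT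
    (fun z : measurableTypeR R * measurableTypeR R => `|z.1 - z.2|%:E).
  by apply: measurable_dist; [exact: measurable_fst|exact: measurable_snd].
(* The bounds are kept additive because the cost may be infinite; nonnegativity of [f] lets the
   integrals add. *)
have H1 : (\int[pi]_z (f z.1)%:E <=
    \int[pi]_z `|z.1 - z.2|%:E + \int[pi]_z (f z.2)%:E)%E.
  rewrite -ge0_integralD//; last by move=> z _; rewrite lee_fin.
  apply: ge0_le_integral => //.
  - by move=> z _; rewrite lee_fin.
  - exact: emeasurable_funD.
  - move=> z _; rewrite -EFinD lee_fin -lerBlDr.
    exact: le_trans (ler_norm _) (fL _ _).
have H2 : (\int[pi]_z (f z.2)%:E <=
    \int[pi]_z `|z.1 - z.2|%:E + \int[pi]_z (f z.1)%:E)%E.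
  rewrite -ge0_integralD//; last by move=> z _; rewrite lee_fin.
  apply: ge0_le_integral => //.
  - by move=> z _; rewrite lee_fin.
  - exact: emeasurable_funD.
  - move=> z _; rewrite -EFinD lee_fin -lerBlDr distrC.
    exact: le_trans (ler_norm _) (fL _ _).
move: H1 H2; rewrite -E1 -E2 -(fineK fin1) -(fineK fin2).
(* A cost of [+oo] makes the claim trivial, and [-oo] contradicts the bounds. *)
case: (integral pi _ _) => [v| |]; last 2 first.
- by move=> _ _; exact: leey.
- by [].
rewrite -EFinB -!EFinD abse_EFin !lee_fin => H1 H2.
by rewrite ler_norml; apply/andP; split; lra.
Qed.

(** If all ramp integrals agreed, the laws would coincide and the diagonal coupling would have cost
    0. *)
Lemma W1_gt0_ramp (m1 m2 : probability (measurableTypeR R) R) :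
  (0 < W1 m1 m2)%E -> exists a e, 0 < e /\
    (\int[m1]_t (ramp a e t)%:E)%E <> (\int[m2]_t (ramp a e t)%:E)%E.
Proof.
move=> W0; apply: contrapT => H.
have m12 : forall A, measurable A -> m1 A = m2 A.
  apply: integral_ramp_eq => a e e0; apply: contrapT => ne.
  by apply: H; exists a, e.
move: W0; apply/negP; rewrite -leNgt.
have [Q QE] : exists Q : probability
    (measurableTypeR R * measurableTypeR R)%type R, (Q : set _ -> \bar R) = pushforward m1 (fun t => (t, t)).
  by apply: pushforward_probability; exact: measurable_fun_pair.
apply: (@le_trans _ _ (\int[Q]_z `|z.1 - z.2|%:E)%E).
  apply: ereal_inf_lbound; exists Q => // A mA; rewrite QE /pushforward.
  by split; [|rewrite -m12//]; congr (m1 _); apply/seteqP; split => t //= [].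
rewrite QE ge0_integral_pushforward//; last 2 first.
- exact: measurable_fun_pair.
- by apply: measurable_dist; [exact: measurable_fst|exact: measurable_snd].
rewrite integral0_eq// => t _ /=; by rewrite subrr normr0.
Qed.

Lemma W1_weakly_cvg_lower_bound
    (m : nat -> {measure set (measurableTypeR R) -> \bar R})
    (nu mu : probability (measurableTypeR R) R) :
  weakly_cvg m nu -> (0 < W1 nu mu)%E ->
  exists2 d : R, 0 < d & \forall n \near \oo, (d%:E <= W1 (m n) mu)%E.
Proof.
move=> mnu /W1_gt0_ramp[a [e [e0 ne]]].
have ramp_fin (p : probability (measurableTypeR R) R) :
    (\int[p]_t (ramp a e t)%:E)%E \is a fin_num.
  rewrite ge0_fin_numE; last first.
    by apply: integral_ge0 => t _; rewrite lee_fin ramp_ge0.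
  apply: le_lt_trans (integral_ramp_le _ _ (ltW e0)) _.
  apply: (@le_lt_trans _ _ (e%:E * 1)%E); last by rewrite mule1 ltry.
  by apply: lee_wpmul2l; [rewrite lee_fin ltW|exact: probability_le1].
have ramp_bounded : exists M, forall t, `|ramp a e t| <= M.
  by exists e => t; rewrite ger0_norm ?ramp_ge0// ramp_le// ltW.
have := mnu _ (@continuous_ramp R a e) ramp_bounded.
(* The measures [m n] need not have finite mass; convergence to a finite limit makes their ramp
   integrals eventually finite. *)
rewrite -(fineK (ramp_fin nu)) => /fine_cvgP[finm cvgm].
set b := fine _ in cvgm; pose c := fine (\int[mu]_t (ramp a e t)%:E)%E.
have bc : 0 < `|b - c|.
  rewrite normr_gt0 subr_eq0; apply/eqP => bc; apply: ne.
  by rewrite -(fineK (ramp_fin nu)) -(fineK (ramp_fin mu)) -/b -/c bc.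
(* Half the gap survives, since the ramp integrals against [m n] end up within the other half of
   [b]. *)
exists (`|b - c| / 2); first by rewrite divr_gt0.
near=> n.
have fn : (\int[m n]_t (ramp a e t)%:E)%E \is a fin_num by near: n.
apply: le_trans (@lipschitz_integral_W1 (m n) mu _ (measurable_ramp a e)
  (ramp_ge0 a e) (ramp_lipschitz a e) fn (ramp_fin mu)).
rewrite -(fineK fn) -(fineK (ramp_fin mu)) -EFinB abse_EFin lee_fin -/c.
have : `|b - fine (\int[m n]_t (ramp a e t)%:E)%E| < `|b - c| / 2.
  by near: n; move/cvgrPdist_lt : cvgm; apply; rewrite divr_gt0.
set x := fine _.
by have := ler_distD x b c; lra.
Unshelve. all: by end_near. Qed.

End W1_lower_bound.

(** * From events that almost surely hold eventually to probabilities tending to 1 *)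

Lemma ae_near_cvg_probability1 (R : realType) (d : measure_display)
    (T : measurableType d) (P : probability T R) (E : nat -> set T) :
  (forall n, measurable (E n)) ->
  {ae P, forall w, \forall n \near \oo, E n w} ->
  P (E n) @[n --> \oo] --> 1%E.
Proof.
(* The tail intersections [F N] increase to an event of probability 1, and [F n] lies inside
   [E n]. *)
move=> mE aeE; pose F N := \bigcap_(n in [set n | (N <= n)%N]) E n.
have mF N : measurable (F N) by apply: bigcap_measurableType => n _.
have mUF : measurable (\bigcup_N F N) by exact: bigcup_measurable.
have PF : P (\bigcup_N F N) = 1%E.
  rewrite -(probability_setT P) -(setvU (\bigcup_N F N)) measureU//; last 2 first.
  - exact: measurableC.
  - by rewrite setICl.
  rewrite [X in (X + _)%E](_ : _ = 0%E) ?add0e//.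
  apply/negligibleP; first exact: measurableC.
  apply: negligibleS aeE => w /= nFw Ew; apply: nFw.
  by have [N _ NE] := Ew; exists N => // n /= Nn; exact: NE.
have cF : P (F N) @[N --> \oo] --> 1%E.
  rewrite -PF; apply: nondecreasing_cvg_mu => // m n mn.
  apply/subsetPset => w Fw k /= nk; apply: Fw; exact: leq_trans nk.
apply: squeeze_cvge cF (cvg_cst _); apply: nearW => n.
rewrite probability_le1// andbT le_measure ?inE//.
by move=> w; apply => /=.
Qed.

Theorem proposition2 (R : realType)
  (mu : probability (measurableTypeR R) R)
  (* the observed sequence *)
  (d : measure_display) (T : measurableType d) (P : probability T R)
  (X : nat -> {RV P >-> measurableTypeR R})
  (X_stationary : stationary P succn X)
  (X_ergodic : ergodic P succn X)
  (* the null limit *)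
  (d0 : measure_display) (T0 : measurableType d0) (P0 : probability T0 R)
  (X0 : int -> {RV P0 >-> measurableTypeR R})
  (X0_stationary : stationary P0 (fun k : int => k + 1) X0)
  (X0_marginal : forall (k : int) (A : set (measurableTypeR R)),
     measurable A -> distribution P0 (X0 k) A = mu A)
  (d1 : measure_display) (T1 : measurableType d1) (P1 : probability T1 R)
  (G : T1 -> L1 R)
  (G_gaussian : L1_centered_gaussian P1 G)
  (G_covariance : null_covariance mu P0 X0 P1 G)
  (* the level *)
  (alpha : R) (alpha_gt0 : 0 < alpha) (alpha_lt1 : alpha < 1)
  (* the alternative *)
  (nu : probability (measurableTypeR R) R)
  (X_cvg : {ae P, forall w, weakly_cvg (fun n => empirical X n w) nu})
  (nu_neq_mu : (0 < W1 nu mu)%E) :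
  P [set w | ((quantile P1 (fun w1 => L1_norm (G w1)) (1 - alpha))%:E
                < test_stat X mu n w)%E] @[n --> \oo] --> 1%E.
Proof.
set q := quantile _ _ _.
apply: ae_near_cvg_probability1 => [n|].
  rewrite -[X in measurable X]setTI; apply: emeasurable_fun_o_infty => //.
  apply: measurable_funeM.
  by apply: (measurable_W1_empirical (X := fun i => X i)) => i.
apply: filterS X_cvg => w Xw.
have [c c0 Wc] := W1_weakly_cvg_lower_bound Xw nu_neq_mu.
near=> n; rewrite /test_stat.
apply: (@lt_le_trans _ _ (Num.sqrt n%:R * c)%:E); last first.
  rewrite EFinM; apply: lee_wpmul2l; first by rewrite lee_fin sqrtr_ge0.
  by near: n.
(* The sign of [q] is unknown, so [q / c] is bounded by its absolute value, the square root of
   [(q / c) ^+ 2], which [n] eventually exceeds. *)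
rewrite lte_fin -ltr_pdivrMr// (le_lt_trans (ler_norm _))//.
have qn : (q / c) ^+ 2 < n%:R by near: n; exact: nbhs_infty_gtr.
by rewrite -sqrtr_sqr ltr_sqrt// (le_lt_trans (sqr_ge0 (q / c))).
Unshelve. all: by end_near. Qed.
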